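(* Let $d\ge 1$ and let $a_0,\dots,a_{d-1}$ be nonnegative integers with $a_{d-1},a_0\ge 1$ such that the word $a_{d-1}\cdots a_0$ is lexicographically greater than all its shifts. Let $\gamma$ be the unique positive solution of the equation $x^d=a_{d-1}x^{d-1}+\cdots+a_0$, assume $\gamma>1$, and let $S_\gamma$ be the corresponding beta-shift, which is an SFT. Let $n\ge 2$ be an integer, and consider the word $(na_{d-1})(n^2a_{d-2})\cdots(n^da_0)$, whose $j$-th letter is the integer $n^ja_{d-j}$ for $1\le j\le d$. (1) If $(na_{d-1})(n^2a_{d-2})\cdots(n^da_0)$ is lexicographically greater than all its shifts, then $S_{n\gamma}$ is topologically conjugate to $S_n\times S_\gamma$. (2) Conversely, if $(na_{d-1})(n^2a_{d-2})\cdots(n^da_0)$ is not lexicographically greater than all its shifts, then either $S_{n\gamma}$ is not an SFT, or $S_{n\gamma}$ and $S_n\times S_\gamma$ have different zeta functions. In particular, in this case $S_{n\gamma}$ and $S_n\times S_\gamma$ are not conjugate.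
   Context: Notation: $\mathbb{N}=\{0,1,2,\dots\}$. The shift map is $\sigma(x)[i]=x[i+1]$, on two-sided or one-sided infinite sequences. A subshift is a nonempty closed set $X\subseteq A^{\mathbb{Z}}$ ($A$ finite) with $\sigma(X)=X$; $L(X)$ is the set of finite words occurring in elements of $X$. SFT means subshift of finite type. Two subshifts are (topologically) conjugate if there is a homeomorphism between them commuting with the shift maps. The product of two subshifts is regarded as a subshift over the product alphabet with the coordinatewise shift. A nonempty word $w$ over $\mathbb{N}$ is lexicographically greater than all its shifts if $w0^\infty>\sigma^i(w0^\infty)$ in the lexicographic order for every $i>0$, where $w0^\infty$ is the one-way infinite sequence consisting of $w$ followed by zeros. Beta-shifts: for real $\beta>1$ let $T_\beta:[0,1]\to[0,1]$, $T_\beta(\xi)=\beta\xi-\lfloor\beta\xi\rfloor$, and let $d(\beta)=d_0d_1d_2\cdots$ be the sequence with $d_i=\lfloor\beta\, T_\beta^{i}(1)\rfloor$ for $i\in\mathbb{N}$. Let $Y_\beta=\{d_0d_1\cdots d_{m-1}b\mid m\in\mathbb{N},\ b\in\mathbb{N},\ 0\le b<d_m\}$. The beta-shift $S_\beta\subseteq\{0,1,\dots,\lfloor\beta\rfloor\}^{\mathbb{Z}}$ is the subshift whose language $L(S_\beta)$ is the set of all subwords of finite concatenations of elements of $Y_\beta$. For an integer $n\ge 2$, $S_n=\{0,\dots,n-1\}^{\mathbb{Z}}$. The zeta function of a subshift $X$ is the formal power series $\zeta_X(t)=\exp\left(\sum_{k\ge 1}\frac{p_k(X)}{k}t^k\right)$,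 where $p_k(X)$ is the number of $x\in X$ with $\sigma^k(x)=x$. *)

(* Defs.v *)
From HB Require Import structures.
From mathcomp Require Import all_boot all_order all_algebra finmap.
From mathcomp Require Import all_classical all_reals all_analysis.
From mathcomp Require Import zify.

Set Implicit Arguments.
Unset Strict Implicit.
Unset Printing Implicit Defensive.

Import Order.TTheory GRing.Theory Num.Theory.

Local Open Scope classical_set_scope.
Local Open Scope ring_scope.

(* A^Z with the product of the discrete topologies. *)
Notation biseq A := {ptws int -> discrete_topology A}.

Definition shift (A : finType) (x : biseq A) : biseq A := fun i => x (i + 1).

Definition word_at (A : finType) (x : biseq A) (i : int) (k : nat) : seq A :=
  mkseq (fun j => x (i + j%:Z)) k.

Definition language (A : finType) (X : set (biseq A)) : set (seq A) :=
  [set w | exists2 x, X x & exists i, word_at x i (size w) = w].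

Definition subshift (A : finType) (X : set (biseq A)) : Prop :=
  [/\ X !=set0, closed X & @shift A @` X = X].

Definition SFT (A : finType) (X : set (biseq A)) : Prop :=
  subshift X /\
  exists F : seq (seq A),
    X = [set x | forall w i, w \in F -> word_at x i (size w) <> w].

(* The values of f outside X and of g outside Y are irrelevant. *)
Definition conjugate (A B : finType) (X : set (biseq A)) (Y : set (biseq B)) :
    Prop :=
  exists (f : biseq A -> biseq B) (g : biseq B -> biseq A),
    [/\ [/\ {within X, continuous f} & {within Y, continuous g}],
        [/\ forall x, X x -> Y (f x) & forall y, Y y -> X (g y)],
        [/\ forall x, X x -> g (f x) = x & forall y, Y y -> f (g y) = y] &
        forall x, X x -> f (shift x) = shift (f x)].

Definition full_shift (n : nat) : set (biseq 'I_n) := setT.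

Arguments full_shift n : clear implicits.

Definition prod_shift (A B : finType) (X : set (biseq A)) (Y : set (biseq B)) :
    set (biseq (A * B)%type) :=
  [set z | X (fun i => (z i).1) /\ Y (fun i => (z i).2)].

(* For k > 0 the set of points of X fixed by sigma^k is finite, so fset_set
   does not take its default value. *)
Definition periodic_count (A : finType) (X : set (biseq A)) (k : nat) : nat :=
  #|` fset_set [set x : biseq A | X x /\ iter k (@shift A) x = x]|.

(* A formal power series is given by its coefficient sequence.  The series
   F = \sum_(k >= 1) (p_k / k) t^k has zero constant term, so the coefficient
   of t^m in exp F = \sum_j F^j / j! only involves j <= m and the terms of F of
   degree at most m. *)
Definition zeta (A : finType) (X : set (biseq A)) (m : nat) : rat :=
  let F : {poly rat} :=
    \poly_(k < m.+1) (if k == 0%N then 0 else (periodic_count X k)%:R / k%:R) in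
  (\sum_(j < m.+1) (j`!%:R)^-1 *: F ^+ j)`_m.

Definition seq_lex_lt (u v : nat -> nat) : Prop :=
  exists m, (forall j, (j < m)%N -> u j = v j) /\ (u m < v m)%N.

(* nth 0 w is the one-sided sequence w 0^oo. *)
Definition gt_all_shifts (w : seq nat) : Prop :=
  w <> [::] /\
  forall i, (0 < i)%N -> seq_lex_lt (fun j => nth 0%N w (i + j)) (nth 0%N w).

Definition beta_map (R : realType) (beta xi : R) : R :=
  beta * xi - (Num.floor (beta * xi))%:~R.

(* Num.truncn is the nat-valued floor on nonnegative reals. *)
Definition beta_digit (R : realType) (beta : R) (i : nat) : nat :=
  Num.truncn (beta * iter i (beta_map beta) 1).

Definition beta_block (R : realType) (beta : R) : set (seq nat) :=
  [set w | exists m b, (b < beta_digit beta m)%N /\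
                       w = rcons (mkseq (beta_digit beta) m) b].

Definition beta_factor (R : realType) (beta : R) : set (seq nat) :=
  [set w | exists s : seq (seq nat),
     (forall v, v \in s -> beta_block beta v) /\ infix w (flatten s)].

(* The subshift with language beta_factor beta: see subshift_beta_shift and
   language_beta_shift below.  For an integer beta the top letter beta of the
   alphabet does not occur, and only the letters 0, ..., beta - 1 are used. *)
Definition beta_shift (R : realType) (beta : R) :
    set (biseq 'I_(Num.truncn beta).+1) :=
  [set x | forall i k, beta_factor beta [seq val a | a <- word_at x i k]].

Arguments beta_shift {R} beta.

Section BetaShiftFacts.

Variables (R : realType) (beta : R).
Hypothesis beta_gt1 : 1 < beta.

Let beta_ge0 : 0 <= beta. Proof. exact: ltW (lt_trans ltr01 beta_gt1). Qed.

Lemma beta_orbit_itv i : 0 <= iter i (beta_map beta) 1 <= 1.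
Proof.
elim: i => [|i _] /=; first by rewrite ler01 lexx.
rewrite /beta_map; set y := beta * _.
have /andP[h1 h2] := floor_itv y.
rewrite subr_ge0 h1 /= lerBlDl.
by move: h2; rewrite intrD => /ltW.
Qed.

Lemma beta_digit_le i : (beta_digit beta i <= Num.truncn beta)%N.
Proof.
apply: le_truncn; have /andP[_ h] := beta_orbit_itv i.
by rewrite -[leRHS]mulr1 ler_wpM2l.
Qed.

Lemma beta_block0 : beta_block beta [:: 0%N].
Proof.
exists 0%N, 0%N; split => //.
by rewrite /beta_digit /= mulr1 truncn_gt0 ltW.
Qed.

Lemma beta_block_le v a : beta_block beta v -> a \in v ->
  (a <= Num.truncn beta)%N.
Proof.
move=> [m [b [bm ->]]]; rewrite mem_rcons inE => /orP[/eqP->|].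
  exact: leq_trans (ltnW bm) (beta_digit_le m).
by case/mapP=> j _ ->; exact: beta_digit_le.
Qed.

Lemma beta_factor_extend (w : seq nat) : beta_factor beta w ->
  exists2 x, beta_shift beta x &
    [seq val a | a <- word_at x 0 (size w)] = w.
Proof.
move=> [s [sB /infixP[u [v e]]]].
set c := flatten s in e.
have cle j : (nth 0%N c j < (Num.truncn beta).+1)%N.
  have [jc|jc] := ltnP j (size c); last by rewrite nth_default.
  have /flattenP[v' v's] : nth 0%N c j \in flatten s by exact: mem_nth.
  by rewrite ltnS; apply: beta_block_le; exact: sB.
pose y (i : int) : nat :=
  if 0 <= i + (size u)%:Z then nth 0%N c (absz (i + (size u)%:Z)) else 0%N.
have yle i : (y i < (Num.truncn beta).+1)%N by rewrite /y; case: ifP.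
pose x : biseq 'I_(Num.truncn beta).+1 := fun i => Ordinal (yle i).
have wE i k : [seq val a | a <- word_at x i k] = mkseq (fun j => y (i + j%:Z)) k.
  by rewrite /word_at /mkseq -map_comp.
exists x.
  move=> i k; rewrite wE.
  pose p := absz i.
  pose q := (absz i + size u + k)%N.
  exists (nseq p [:: 0%N] ++ s ++ nseq q [:: 0%N]); split.
    move=> v'; rewrite !mem_cat => /or3P[| /sB //|];
      by move=> /nseqP[-> _]; exact: beta_block0.
  have f0 r : flatten (nseq r [:: 0%N]) = nseq r 0%N.
    by elim: r => //= r ->.
  rewrite !flatten_cat !f0 -/c.
  pose o : nat := absz (i + (size u)%:Z + p%:Z).
  have oE : o%:Z = i + (size u)%:Z + p%:Z by rewrite /o /p; lia.
  set z := nseq p 0%N ++ _.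
  have -> : mkseq (fun j => y (i + j%:Z)) k = take k (drop o z).
    have szk : size (take k (drop o z)) = k.
      rewrite size_takel // size_drop !size_cat !size_nseq /q.
      rewrite /p in oE *; lia.
    apply: (@eq_from_nth _ 0%N); rewrite size_mkseq ?szk // => j jk.
    rewrite nth_mkseq // nth_take // nth_drop /z nth_cat size_nseq /y.
    have [ojp|ojp] := ltnP.
      rewrite nth_nseq ojp.
      by have -> : (0 <= i + j%:Z + (size u)%:Z) = false by lia.
    have -> : (0 <= i + j%:Z + (size u)%:Z) by lia.
    have -> : absz (i + j%:Z + (size u)%:Z) = (o + j - p)%N by lia.
    rewrite nth_cat; case: ltnP => // h.
    by rewrite nth_default // nth_nseq if_same.
  by apply/infixP; exists (take o z), (drop k (drop o z));
    rewrite cat_take_drop cat_take_drop.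
rewrite wE; apply: (@eq_from_nth _ 0%N); rewrite size_mkseq // => j jw.
rewrite nth_mkseq // /y add0r.
have -> : 0 <= j%:Z + (size u)%:Z by lia.
have -> : absz (j%:Z + (size u)%:Z) = (size u + j)%N by lia.
by rewrite e nth_cat ltnNge leq_addr /= addKn nth_cat jw.
Qed.

Lemma language_beta_shift (w : seq 'I_(Num.truncn beta).+1) :
  language (beta_shift beta) w <-> beta_factor beta [seq val a | a <- w].
Proof.
split=> [[x Xx [i <-]]|/beta_factor_extend[x Xx]]; first exact: Xx.
rewrite size_map => /(inj_map val_inj) e.
by exists x => //; exists 0.
Qed.

Lemma subshift_beta_shift : subshift (beta_shift beta).
Proof.
split.
- have [] := @beta_factor_extend [::]; last by move=> x; exists x.
  by exists [::]; split.
- move=> x clx i k.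
  have near_word : nbhs x [set y | word_at y i k = word_at x i k].
    have nF : Filter (nbhs x) by exact: nbhs_filter.
    elim: k => [|k IH].
      by apply: (@filterS _ _ nF setT) => [y _|]; rewrite ?/word_at //;
        exact: (@filterT _ _ nF).
    have h : nbhs x [set y | y (i + k%:Z) = x (i + k%:Z)].
      have /= := @proj_continuous int
        (fun _ => discrete_topology 'I_(Num.truncn beta).+1) (i + k%:Z) x.
      by move=> /(_ [set x (i + k%:Z)]); apply; rewrite nbhs_principalE.
    apply: (@filterS2 _ _ nF _ _ _ _ IH h) => y /= e e'.
    by rewrite /word_at !mkseqS e'; rewrite /word_at in e; rewrite e.
  by have [y [Xy <-]] := clx _ near_word; exact: Xy.
- apply/seteqP; split => [_ [x Xx <-] i k|x Xx].
    have -> : word_at (shift x) i k = word_at x (i + 1) k.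
      by apply: eq_map => j; rewrite /shift addrAC.
    exact: Xx.
  exists (fun i => x (i - 1)); last first.
    by apply/funext => i; rewrite /shift addrK.
  move=> i k.
  have -> : word_at (fun i => x (i - 1)) i k = word_at x (i - 1) k.
    by apply: eq_map => j; rewrite addrAC.
  exact: Xx.
Qed.

End BetaShiftFacts.

(* Main.v *)
From mathcomp Require Import all_boot all_order all_algebra finmap.
From mathcomp Require Import all_classical all_reals all_analysis.
From mathcomp Require Import zify ring lra.
Require Import Defs.

Set Implicit Arguments.
Unset Strict Implicit.
Unset Printing Implicit Defensive.

Import Order.TTheory GRing.Theory Num.Theory.

Local Open Scope classical_set_scope.
Local Open Scope ring_scope.

(** Let e be the digit sequence of gamma and f_j = n^(j+1) e_j.  The word
    w is the beginning of f, and being greater than all its shifts is a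
    property of its extension by zeros ([parry]).

    Points of a beta-shift are bi-infinite concatenations of blocks
    e_0 ... e_(m-1) b with b < e_m.  Reading a point letter by letter, one only
    has to remember how many letters of the current block have been read; this
    state goes up by one on the letter e_s and returns to 0 on a smaller one.
    Everything rests on one consequence of [parry]: of two parses of the same
    word, the one that is ahead returns to 0 no earlier than the other, and when
    it does, so does the other ([border_run], [run_merge]).  Hence parses that
    start differently agree after the first common block end.

    When f is parry, it is the digit sequence of n gamma, because a finite parry
    sequence whose associated polynomial vanishes at beta is the expansion of 1
    in base beta ([finite_beta_digit]).  The blocks for f that end in state s
    come in n^(s+1) e_s kinds: a block for e of the same length together with
    s + 1 letters of the full shift, packed as the base n digits of a quotient.
    The state is a function of finitely many letters of the past, so this
    translation of blocks is a sliding block code, as is its inverse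
    ([scale_conjugate]).

    For the converse, no finiteness is needed.  For every beta > 1 the digit
    sequence is parry and, being greater than its own shifts, is not periodic,
    so a periodic point has exactly one periodic parse.  The points of period k
    are therefore in bijection with the closed paths of length k in the graph
    of states, where s -> s + 1 has weight 1 and s -> 0 has weight e_s
    ([periodic_count_code]).  A closed path of length k uses the weights
    e_0, ..., e_(k-1) only, and it uses e_(k-1) only as a single block; so the
    numbers of closed paths determine e ([closed_walks_inj]).  Replacing e by f
    multiplies the number of closed paths of length k by n^k, the number of
    points of period k of the full shift.  If the zeta functions agree, the
    digit sequence of n gamma must then be f, which makes f parry.  So when w is
    not greater than all its shifts the zeta functions differ, and no conjugacy
    can exist, since the zeta function is a conjugacy invariant. *)

(** * Parsing words into blocks *)

(** Parry's condition on expansions of 1 in a real base. *)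
Definition parry (e : nat -> nat) : Prop :=
  forall i, (0 < i)%N -> seq_lex_lt (fun j => e (i + j)%N) e.

Definition block (e : nat -> nat) (w : seq nat) : Prop :=
  exists m b, (b < e m)%N /\ w = rcons (mkseq e m) b.

Definition block_factor (e : nat -> nat) (w : seq nat) : Prop :=
  exists s : seq (seq nat), (forall v, v \in s -> block e v) /\
    infix w (flatten s).

(** The state s is the number of letters of the current block already read;
    None means that the letter b cannot follow. *)
Definition step (e : nat -> nat) (s b : nat) : option nat :=
  if (b < e s)%N then Some 0%N else if b == e s then Some s.+1 else None.

Fixpoint run (e : nat -> nat) (s : nat) (w : seq nat) : option nat :=
  if w is b :: w' then obind (fun t => run e t w') (step e s b) else Some s.

Section Automaton.

Variable e : nat -> nat.

Lemma run_cat s u v : run e s (u ++ v) = obind (run e ^~ v) (run e s u).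
Proof. by elim: u s => //= b u IH s; case: (step e s b). Qed.

Lemma run_rcons s u b :
  run e s (rcons u b) = obind (step e ^~ b) (run e s u).
Proof.
rewrite -cats1 run_cat; case: (run e s u) => //= t.
by case: (step e t b).
Qed.

Lemma run_cat_some s u v t : run e s (u ++ v) = Some t ->
  exists2 r, run e s u = Some r & run e r v = Some t.
Proof. by rewrite run_cat; case: (run e s u) => //= r; exists r. Qed.

Lemma run_mkseq m : run e 0 (mkseq e m) = Some m.
Proof.
elim: m => // m IH.
by rewrite mkseqS run_rcons IH /= /step ltnn eqxx.
Qed.

(** A run either stays inside one block, or its last return to 0 cuts the word
    before a beginning of e. *)
Lemma run_decomp s w t : run e s w = Some t ->
  t = (s + size w)%N /\ (forall j, (j < size w)%N -> nth 0%N w j = e (s + j)%N)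
  \/ exists w1, w = w1 ++ mkseq e t /\ run e s w1 = Some 0%N.
Proof.
elim/last_ind: w t => [|w b IH] t.
  by case=> <-; left; rewrite addn0.
rewrite run_rcons; case E: (run e s w) => [r|] //=.
rewrite /step; case: ltnP => [br [<-]|_].
  right; exists (rcons w b); rewrite cats0 run_rcons E /= /step br; split=> //.
case: eqP => // -> [<-].
case: (IH _ E) => [[rE wE]|[w1 [wE w1E]]]; [left|right].
  split=> [|j]; rewrite size_rcons ?rE ?addnS // nth_rcons ltnS leq_eqVlt.
  by case: ltngtP => // [jw _|-> _]; rewrite ?wE // -rE.
by exists w1; rewrite mkseqS wE rcons_cat.
Qed.

Lemma run0_decomp w t : run e 0 w = Some t ->
  exists2 w1, w = w1 ++ mkseq e t & run e 0 w1 = Some 0%N.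
Proof.
case/run_decomp=> [[-> wE]|[w1 []]]; last by exists w1.
exists [::] => //=; apply: (@eq_from_nth _ 0%N); rewrite ?size_mkseq // => j jw.
by rewrite nth_mkseq // wE.
Qed.

Lemma run_flatten ss : (forall v, v \in ss -> block e v) ->
  run e 0 (flatten ss) = Some 0%N.
Proof.
elim: ss => //= v ss IH h; rewrite run_cat.
have [m [b [bm ->]]] : block e v by apply: h; rewrite mem_head.
rewrite run_rcons run_mkseq /= /step bm /=; apply: IH => u us.
by apply: h; rewrite inE us orbT.
Qed.

(** Cutting off the last block: before its final letter the state t has been
    reached by reading e_0 ... e_(t-1) from 0. *)
Lemma run00_flatten w : run e 0 w = Some 0%N ->
  exists2 ss, (forall v, v \in ss -> block e v) & flatten ss = w.
Proof.
have [k] := ubnP (size w); elim: k w => // k IH w.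
case/lastP: w => [|w b]; first by exists [::].
rewrite size_rcons ltnS run_rcons => wk; case E: (run e 0 w) => [t|] //=.
rewrite /step; case: ltnP => [bt _|_]; last by case: eqP.
have [w1 wE w1E] := run0_decomp E.
have [|ss ssB ssE] := IH w1 _ w1E.
  by apply: leq_ltn_trans wk; rewrite wE size_cat leq_addr.
exists (rcons ss (rcons (mkseq e t) b)); last first.
  by rewrite flatten_rcons ssE wE rcons_cat.
move=> v; rewrite mem_rcons inE => /orP[/eqP->|]; last exact: ssB.
by exists t, b.
Qed.

Lemma factor_run w : block_factor e w ->
  exists p q s t, [/\ run e 0 p = Some s, run e s w = Some t &
    run e t q = Some 0%N].
Proof.
move=> [ss [ssB /infixP[p [q E]]]].
have := run_flatten ssB; rewrite E => /run_cat_some[s ps].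
by move=> /run_cat_some[t wt qt]; exists p, q, s, t.
Qed.

Lemma run_factor u v w : run e 0 (u ++ v ++ w) = Some 0%N -> block_factor e v.
Proof.
case/run00_flatten=> ss ssB E; exists ss; split=> //.
by apply/infixP; exists u, w.
Qed.

End Automaton.

Definition window (x : int -> nat) (i : int) (k : nat) : seq nat :=
  mkseq (fun j => x (i + j%:Z)) k.

Lemma window_cat x i k m :
  window x i (k + m) = window x i k ++ window x (i + k%:Z) m.
Proof.
rewrite /window /mkseq iotaD map_cat add0n; congr (_ ++ _).
rewrite -{1}[k]addn0 iotaDl -map_comp; apply: eq_map => j /=.
by rewrite PoszD addrA.
Qed.

Lemma windowS x i k : window x i k.+1 = x i :: window x (i + 1) k.
Proof. by rewrite -add1n window_cat /window /mkseq /= addr0. Qed.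

Lemma windowSr x i k : window x i k.+1 = rcons (window x i k) (x (i + k%:Z)).
Proof. by rewrite -addn1 window_cat -cats1 /window {2}/mkseq /= addr0. Qed.

Lemma take_window x i j k : (j <= k)%N ->
  take j (window x i k) = window x i j.
Proof.
by move=> jk; rewrite -(subnKC jk) window_cat take_size_cat ?size_mkseq.
Qed.

(** A bi-infinite parse of x: the state before each letter. *)
Definition labels (e : nat -> nat) (x s : int -> nat) : Prop :=
  forall i, step e (s i) (x i) = Some (s (i + 1)).

Section Labels.

Variables (e : nat -> nat) (x s : int -> nat).
Hypothesis sx : labels e x s.

Lemma run_window i k : run e (s i) (window x i k) = Some (s (i + k%:Z)).
Proof.
elim: k i => [|k IH] i; first by rewrite addr0.
by rewrite windowS /= sx /= IH -addrA -PoszD.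
Qed.

(** The window is completed to a concatenation of blocks by the part of the
    first block that precedes it and by the letters up to the next return. *)
Lemma factor_window i k : (forall j, exists m, s (j + m%:Z) = 0%N) ->
  block_factor e (window x i k).
Proof.
move=> s0; have [m sm] := s0 (i + k%:Z).
apply: (@run_factor e (mkseq e (s i)) _ (window x (i + k%:Z) m)).
by rewrite -window_cat run_cat run_mkseq /= run_window PoszD addrA sm.
Qed.

End Labels.

Section Parry.

Variable e : nat -> nat.
Hypothesis eP : parry e.

(** s is the length of a border of the word e_0 ... e_(t-1): this is how the
    states s and t of two parses of the same word are related. *)
Definition border (s t : nat) : Prop :=
  (s <= t)%N /\ forall i, (i < s)%N -> e (t - s + i)%N = e i.

Lemma border0 t : border 0 t. Proof. by []. Qed.

(** Shifting e by t - s leaves its first s letters unchanged, so the comparison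
    of e with this shift is not decided before the letters e_s and e_t. *)
Lemma border_le s t : border s t -> (e t <= e s)%N.
Proof.
move=> [st est]; move: (st); rewrite leq_eqVlt => /orP[/eqP->//|lt_st].
have [|m [eq_m lt_m]] := eP (i := (t - s)%N); first by rewrite subn_gt0.
have -> : e t = e (t - s + s)%N by rewrite subnK // ltnW.
case: (ltngtP m s) => [ms|sm|ms]; last by move: lt_m; rewrite ms => /ltnW.
  by move: lt_m; rewrite est // ltnn.
by rewrite eq_m.
Qed.

(** Any letter that is legal in the state ahead is legal in the state behind,
    where it can only be further from the bound e_s. *)
Lemma border_step s t b t' : border s t -> step e t b = Some t' ->
  exists2 s', step e s b = Some s' & border s' t'.
Proof.
move=> st; have le_e := border_le st; rewrite /step.
case: ltnP => [bt [<-]|_].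
  by exists 0%N; rewrite ?(leq_trans bt le_e).
case: eqP => // -> [<-]; move: le_e; rewrite leq_eqVlt => /orP[/eqP E|lt_e].
  exists s.+1; first by rewrite E ltnn eqxx.
  case: st => st est; split=> // i; rewrite ltnS leq_eqVlt subSS.
  by case/orP=> [/eqP->|/est //]; rewrite subnK.
by exists 0%N; rewrite ?lt_e.
Qed.

Lemma border_run s t w t' : border s t -> run e t w = Some t' ->
  exists2 s', run e s w = Some s' & border s' t'.
Proof.
elim: w s t => [|b w IH] s t st /=; first by case=> <-; exists s.
case E: (step e t b) => [r|] //= rw.
by have [q -> qr] := border_step st E; exact: IH qr rw.
Qed.

(** The bound on t' says that the run from t has returned to 0; at that moment
    the other state is the length of a border of the empty word. *)
Lemma run_merge s t w t' : border s t -> run e t w = Some t' ->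
  (t' < t + size w)%N -> run e s w = Some t'.
Proof.
move=> st tw; case/run_decomp: (tw) => [[->]|[w1 [-> w1E] _]].
  by rewrite ltnn.
have [s' s'E [s'0 _]] := border_run st w1E.
move: s'0; rewrite leqn0 => /eqP s'0.
by rewrite run_cat s'E /= s'0 run_mkseq.
Qed.

Lemma factor_run0 w : block_factor e w -> exists t, run e 0 w = Some t.
Proof.
case/factor_run=> p [q [s [t [_ sw _]]]].
by have [t'] := border_run (border0 s) sw; exists t'.
Qed.

(** A periodic sequence equals one of its shifts, while e is strictly greater
    than all of its own. *)
Lemma parry_aperiodic k : (0 < k)%N -> exists j, e (j + k)%N <> e j.
Proof.
move=> k0; have [m [_ lt_m]] := eP k0; exists m => E.
by move: lt_m; rewrite addnC E ltnn.
Qed.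

End Parry.

(** * Digit sequences of real bases *)

Section Digits.

Variables (R : realType) (beta : R).
Hypothesis beta_gt1 : 1 < beta.

Let beta_gt0 : 0 < beta. Proof. exact: lt_trans beta_gt1. Qed.

(** The orbit of 1 under x |-> beta x - e_i, with prescribed digits e_i. *)
Fixpoint residue (e : nat -> nat) (i : nat) : R :=
  if i is j.+1 then beta * residue e j - (e j)%:R else 1.

(** Equal digits are subtracted from both orbits, so the distance between the
    orbits is just multiplied by beta at each step. *)
Lemma residue_diff e i m : (forall j, (j < m)%N -> e (i + j)%N = e j) ->
  residue e (i + m) - residue e m = beta ^+ m * (residue e i - 1).
Proof.
elim: m => [|m IH] h; first by rewrite addn0 mul1r.
rewrite addnS /= h // exprS -mulrA -IH; last first.
  by move=> j jm; apply: h; exact: ltnW.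
ring.
Qed.

Lemma residue_sum e i :
  residue e i = beta ^+ i - \sum_(j < i) (e j)%:R * beta ^+ (i - j.+1).
Proof.
elim: i => [|i IH] /=; first by rewrite big_ord0 subr0.
rewrite big_ord_recr /= subnn mulr1 IH mulrBr -exprS opprD addrA.
congr (_ - _ - _).
rewrite mulr_sumr; apply: eq_bigr => j _.
by rewrite mulrCA -exprS subSS subnSK.
Qed.

Lemma iter_beta_map i :
  iter i (beta_map beta) 1 = residue (beta_digit beta) i.
Proof.
elim: i => //= i IH; rewrite {1}/beta_map -IH; congr (_ - _).
have x0 : 0 <= beta * iter i (beta_map beta) 1.
  by have /andP[h _] := beta_orbit_itv beta i; rewrite mulr_ge0 // ltW.
by rewrite /beta_digit truncn_floor x0 natr_absz ger0_norm ?floor_ge0.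
Qed.

Lemma residue_itv i : 0 <= residue (beta_digit beta) i <= 1.
Proof. by rewrite -iter_beta_map beta_orbit_itv. Qed.

Lemma residue_lt1 i : (0 < i)%N -> residue (beta_digit beta) i < 1.
Proof.
case: i => // i _; rewrite -iter_beta_map /= {1}/beta_map ltrBlDl.
by have /andP[_] := floor_itv (beta * iter i (beta_map beta) 1); rewrite intrD.
Qed.

Lemma beta_digitE i :
  beta_digit beta i = Num.truncn (beta * residue (beta_digit beta) i).
Proof. by rewrite -iter_beta_map. Qed.

Lemma expr_unbounded (M : R) : exists m, M < beta ^+ m.
Proof.
have bernoulli m : m%:R * (beta - 1) <= beta ^+ m.
  elim: m => [|m IH]; first by rewrite mul0r.
  have h : 0 <= (beta - 1) * (beta ^+ m - 1).
    by rewrite mulr_ge0 // subr_ge0 ?exprn_ege1 // ltW.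
  by rewrite exprS -natr1 mulrDl; move: IH h; lra.
exists (Num.bound (`|M| / (beta - 1))); apply: lt_le_trans (bernoulli _).
rewrite -ltr_pdivrMr ?subr_gt0 //.
apply: le_lt_trans (archi_boundP _); last by rewrite divr_ge0 // subr_ge0 ltW.
by rewrite ler_pM2r ?invr_gt0 ?subr_gt0 // ler_norm.
Qed.

(** For i > 0 the orbit point of index i is less than 1.  As long as the digits
    of the two points agree, their order is kept and their distance grows by the
    factor beta; both points stay in [0, 1], so the digits differ at some place,
    and at the first such place the smaller point has the smaller digit. *)
Lemma parry_beta_digit : parry (beta_digit beta).
Proof.
move=> i i0; set e := beta_digit beta.
have gap m : (forall j, (j < m)%N -> e (i + j)%N = e j) ->
    residue e (i + m) < residue e m.
  move=> /residue_diff h; rewrite -subr_lt0 h pmulr_rlt0 ?exprn_gt0 //.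
  by rewrite subr_lt0 residue_lt1.
have neq : exists m, e (i + m)%N != e m.
  apply: contrapT => h; have eqe j : e (i + j)%N = e j.
    by apply: contrapT => /eqP ne; apply: h; exists j.
  have : residue e i < 1 by exact: residue_lt1.
  rewrite -subr_gt0 => gt0; have [m hm] := expr_unbounded (1 - residue e i)^-1.
  have := residue_diff (fun j (_ : (j < m)%N) => eqe j).
  have /andP[h0 _] := residue_itv (i + m); have /andP[_ h1] := residue_itv m.
  move: hm; rewrite -div1r ltr_pdivrMr // => hm.
  by rewrite -/e in h0 h1; nra.
case: (ex_minnP neq) => m ne min; exists m.
have eqm j : (j < m)%N -> e (i + j)%N = e j.
  by move=> jm; apply/eqP/negPn/negP => /min; rewrite leqNgt jm.
split=> //; rewrite ltn_neqAle ne /= /e !beta_digitE le_truncn // ler_pM2l //.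
exact: ltW (gap m eqm).
Qed.

(** The digits e_i are the integer parts as soon as all residues of positive
    index lie in [0, 1).  Since the residues vanish from d on, both bounds are
    proved by descending induction: for the upper one, the comparison of e with
    its shift by i relates the residue i to a later one. *)
Lemma finite_beta_digit (e : nat -> nat) (d : nat) : parry e ->
  (forall j, (d <= j)%N -> e j = 0%N) ->
  beta ^+ d = \sum_(j < d) (e j)%:R * beta ^+ (d - j.+1) ->
  beta_digit beta = e.
Proof.
move=> eP e0 eq_d.
have res0 i : (d <= i)%N -> residue e i = 0.
  elim: i => [|i IH]; rewrite leq_eqVlt => /orP[/eqP dE|//].
  - by rewrite -dE residue_sum eq_d subrr.
  - by rewrite -dE residue_sum eq_d subrr.
  - by rewrite ltnS => di /=; rewrite IH // e0 // mulr0 subrr.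
have res_ge0 i : 0 <= residue e i.
  have [k] := ubnP (d - i); elim: k i => // k IH i; rewrite ltnS => dk.
  have [/res0-> //|id] := leqP d i.
  have /= : 0 <= residue e i.+1 by apply: IH; lia.
  rewrite subr_ge0 -(pmulr_rge0 _ beta_gt0).
  by apply: le_trans.
have res_lt1 i : (0 < i)%N -> residue e i < 1.
  have [k] := ubnP (d - i); elim: k i => // k IH i; rewrite ltnS => dk i0.
  have [/res0-> //|id] := leqP d i.
  have [m [eq_m lt_m]] := eP _ i0.
  have h1 : residue e (i + m).+1 < 1 by apply: IH => //; lia.
  have h0 := res_ge0 m.+1.
  have hd := residue_diff eq_m.
  have bm : 0 < beta ^+ m by exact: exprn_gt0.
  rewrite -subr_lt0 -(pmulr_rlt0 _ bm) -hd -(pmulr_rlt0 _ beta_gt0).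
  move: h1 h0 => /=; move: lt_m; rewrite -(ler_nat R) => lt_m.
  by rewrite -natr1 in lt_m; lra.
have digitE i : e i = Num.truncn (beta * residue e i).
  apply/esym/truncn_def; have := res_ge0 i.+1; have := res_lt1 i.+1 isT => /=.
  by rewrite -natr1; lra.
have resE i : residue (beta_digit beta) i = residue e i.
  elim: i => // i IH /=; rewrite beta_digitE IH -digitE //.
by apply/funext => i; rewrite beta_digitE resE -digitE.
Qed.

End Digits.

(** * Counting closed paths of states *)

(** The weighted number of paths of length m from s to t in the graph of states,
    where the edge s -> s + 1 has weight 1 and the edge s -> 0 has weight e_s. *)
Fixpoint walks (e : nat -> nat) (m s t : nat) : nat :=
  if m is k.+1 then (walks e k s.+1 t + e s * walks e k 0 t)%N else (s == t).

(** In base beta the digit e_j has the value e_j beta^-(j+1): these are the digits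
    to be expected when the base is multiplied by n. *)
Definition scale (n : nat) (e : nat -> nat) (j : nat) : nat :=
  (n ^ j.+1 * e j)%N.

(** A closed path of positive length k passes through 0, so it does not visit
    states larger than k - 1. *)
Definition closed_walks (e : nat -> nat) (k : nat) : nat :=
  (\sum_(s < k) walks e k s s)%N.

Lemma walks_far e m s t : (s + m < t)%N -> walks e m s t = 0%N.
Proof.
elim: m s => [|m IH] s st /=.
  by rewrite ltn_eqF // -[s]addn0.
by rewrite !IH ?muln0 //; lia.
Qed.

(** A path of length m from s to t that uses the edge j -> 0 still has at least
    t steps to make after it, which is why only small weights matter. *)
Lemma leq_walks e f m s t :
    (forall j, (t + j < s + m)%N -> (e j <= f j)%N) ->
  (walks e m s t <= walks f m s t)%N.
Proof.
elim: m s => //= m IH s ef.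
apply: leq_add; first by apply: IH => j jt; apply: ef; lia.
have [tm|mt] := leqP t m; last by rewrite walks_far ?muln0.
by apply: leq_mul; [apply: ef; lia|apply: IH => j jt; apply: ef; lia].
Qed.

(** Among the paths from s to 0 is the one that climbs to s + m and then falls
    to 0, whose weight is e_(s+m). *)
Lemma ltn_walks e f m s :
    (forall j, (j < s + m)%N -> (e j <= f j)%N) -> (e (s + m) < f (s + m))%N ->
  (walks e m.+1 s 0 < walks f m.+1 s 0)%N.
Proof.
elim: m s => [|m IH] s ef lt_ef; first by rewrite /= !muln1 -[s]addn0.
have walksS h : walks h m.+2 s 0 =
  (walks h m.+1 s.+1 0 + h s * walks h m.+1 0 0)%N by [].
rewrite !walksS -addSn; apply: leq_add.
  by apply: IH => [j jm|]; [apply: ef; lia|rewrite addSnnS].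
by apply: leq_mul; [apply: ef|apply: leq_walks => j jt; apply: ef]; lia.
Qed.

Lemma closed_walks_lt e f k : (forall j, (j < k)%N -> e j = f j) ->
  (e k < f k)%N -> (closed_walks e k.+1 < closed_walks f k.+1)%N.
Proof.
move=> ef lt_ef; rewrite /closed_walks !big_ord_recl.
have le_ef j : (j <= k)%N -> (e j <= f j)%N.
  by rewrite leq_eqVlt => /orP[/eqP->|/ef->//]; exact: ltnW.
apply: (@leq_add (_.+1)).
  by apply: ltn_walks => // j jk; apply: le_ef; exact: ltnW.
by apply: leq_sum => i _; apply: leq_walks => j ji; apply: le_ef; lia.
Qed.

Lemma closed_walks_inj e f :
  (forall k, (0 < k)%N -> closed_walks e k = closed_walks f k) -> e = f.
Proof.
move=> ef; apply/funext => k.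
have [m] := ubnP k; elim: m k => // m IH k; rewrite ltnS => km.
have efk j : (j < k)%N -> e j = f j.
  by move=> jk; apply: IH; exact: leq_trans km.
have := ef k.+1 isT.
case: (ltngtP (e k) (f k)) => // lt_ef.
  by have := closed_walks_lt efk lt_ef => /[swap] ->; rewrite ltnn.
have fek j : (j < k)%N -> f j = e j by move=> /efk.
by have := closed_walks_lt fek lt_ef => /[swap] ->; rewrite ltnn.
Qed.

Lemma walks_scale n e m s t :
  (walks (scale n e) m s t * n ^ t = n ^ (s + m) * walks e m s t)%N.
Proof.
elim: m s => [|m IH] s /=.
  by rewrite addn0; case: eqP => [->|_]; rewrite ?muln0 // mulnC.
rewrite mulnDl IH -mulnA IH addSnnS mulnDr; congr (_ + _)%N.
by rewrite add0n mulnACA -expnD addSnnS.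
Qed.

(** The edge s -> 0 closes a block of length s + 1, and the block lengths in a
    closed path add up to its length. *)
Lemma closed_walks_scale n e k : (0 < n)%N ->
  closed_walks (scale n e) k = (n ^ k * closed_walks e k)%N.
Proof.
move=> n0; rewrite /closed_walks big_distrr; apply: eq_bigr => s _ /=.
apply/eqP; rewrite -(eqn_pmul2r (_ : 0 < n ^ s)%N) ?expn_gt0 ?n0 //.
by apply/eqP; rewrite walks_scale expnD -mulnA [LHS]mulnC.
Qed.

Section WordCount.

Variables (e : nat -> nat) (A : nat).
Hypothesis eA : forall i, (e i < A)%N.

Lemma sum_tuple_cons k (T : finType) (F : seq T -> nat) :
  (\sum_(u : k.+1.-tuple T) F u = \sum_b \sum_(u : k.-tuple T) F (b :: u))%N.
Proof.
rewrite pair_bigA /=.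
rewrite (reindex (fun p : T * k.-tuple T => [tuple of p.1 :: p.2])) //=.
exists (fun u => (thead u, [tuple of behead u])) => [[b u] _|u _] /=.
  by congr pair; apply: val_inj.
by rewrite [RHS]tuple_eta; apply: val_inj.
Qed.

Lemma sum_step s (F : option nat -> nat) : F None = 0%N ->
  (\sum_(b < A) F (step e s b) = F (Some s.+1) + e s * F (Some 0))%N.
Proof.
move=> F0; rewrite -(big_mkord xpredT (fun b => F (step e s b))).
rewrite (@big_cat_nat _ _ _ (e s).+1) //= big_nat_recr //=.
rewrite [X in (_ + X)%N]big1_seq ?addn0; last first.
  move=> b; rewrite mem_index_iota /= => /andP[sb _].
  by rewrite /step ltnNge ltnW // gtn_eqF.
rewrite {2}/step ltnn eqxx addnC; congr (_ + _)%N.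
rewrite (eq_big_nat _ _ (F2 := fun=> F (Some 0%N))) => [|b /andP[_ bs]].
  by rewrite sum_nat_const_nat subn0.
by rewrite /step bs.
Qed.

(** The edges of the graph are labelled by the letters: e_s letters lead from s
    to 0, and one letter leads from s to s + 1. *)
Lemma sum_run k s t :
  (\sum_(u : k.-tuple 'I_A) (run e s (map val u) == Some t) = walks e k s t)%N.
Proof.
elim: k s => [|k IH] s.
  rewrite (eq_bigr (fun=> (s == t) : nat)) => [|u _].
    by rewrite sum_nat_const card_tuple expn0 mul1n.
  by rewrite tuple0 /=.
rewrite (sum_tuple_cons k (fun u : seq 'I_A =>
  (run e s (map val u) == Some t) : nat)) /=.
pose F r : nat :=
  (\sum_(u : k.-tuple 'I_A)
    (obind (fun q => run e q (map val u)) r == Some t))%N.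
rewrite (eq_bigr (fun b : 'I_A => F (step e s b))) //.
by rewrite sum_step /F /=; [rewrite -IH -IH|rewrite big1].
Qed.

End WordCount.

Section Periodic.

Variables (T : Type) (x : int -> T) (k : nat).
Hypothesis xk : forall i, x (i + k%:Z) = x i.

Lemma periodicM i m : x (i + (m * k)%N%:Z) = x i.
Proof.
elim: m => [|m IH]; first by rewrite addr0.
by rewrite mulSn addnC PoszD addrA xk.
Qed.

Lemma periodic_mod i : x i = x (i %% k%:Z)%Z.
Proof.
rewrite {1}(divz_eq i k) addrC.
case: (i %/ k)%Z => [m|m]; first by rewrite -PoszM periodicM.
rewrite -[LHS](periodicM _ m.+1) NegzE; congr x; rewrite PoszM.
by rewrite -addrA mulNr addNr addr0.
Qed.

End Periodic.

Section PeriodicLabels.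

Variables (e : nat -> nat) (x : int -> nat) (k : nat).
Hypotheses (k0 : (0 < k)%N) (xk : forall i, x (i + k%:Z) = x i).

Lemma window_periodic i m j : window x (i + (m * k)%N%:Z) j = window x i j.
Proof. by apply: eq_map => l; rewrite addrAC (periodicM xk). Qed.

Lemma run_loop_lt s : run e s (window x 0 k) = Some s -> (s < k)%N.
Proof.
case/run_decomp=> [[]|[w1 [E]]]; rewrite ?size_mkseq; first by lia.
case: w1 E => [_ [->] //|b w1 /(congr1 size)].
by rewrite size_mkseq size_cat /= size_mkseq; lia.
Qed.

(** The run over one period closes up, so its states can be repeated. *)
Lemma periodic_labels s : run e s (window x 0 k) = Some s ->
  exists2 l, labels e x l & forall i, exists m, l (i + m%:Z) = 0%N.
Proof.
move=> run_s.
pose l i := odflt 0%N (run e s (window x 0 (absz (i %% k)%Z))).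
have lP : labels e x l.
  move=> i; rewrite /l (periodic_mod xk).
  have r_lt : (absz (i %% k)%Z < k)%N by lia.
  have rE : (i %% k)%Z = (absz (i %% k)%Z)%:Z by lia.
  have sE : absz ((i + 1) %% k)%Z =
      if (absz (i %% k)%Z).+1 == k then 0%N else (absz (i %% k)%Z).+1.
    rewrite -modzDml rE -PoszD addn1 modz_nat !absz_nat.
    by case: eqP => [->|/eqP ne]; rewrite ?modnn // modn_small // ltn_neqAle ne.
  rewrite {}sE {2}rE; move: (absz _) r_lt => r r_lt {rE}.
  have := run_s; rewrite -{1}(subnKC r_lt) window_cat => /run_cat_some[t].
  rewrite windowSr run_rcons add0r; case E: (run e s _) => [q|] //= stepq _.
  rewrite stepq; case: eqP => [rk|_]; last first.
    by rewrite windowSr run_rcons E /= add0r stepq.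
  by move: run_s; rewrite -rk windowSr run_rcons E /= add0r stepq => -[->].
exists l => // i.
have lk : l (i + k%:Z) = l i by rewrite /l modzDr.
have := run_window lP i k; rewrite lk.
case/run_decomp=> [[]|[w1 [E w1E]]]; first by rewrite size_mkseq; lia.
exists (size w1).
have sz : (size w1 <= k)%N.
  by move: (congr1 size E); rewrite size_mkseq size_cat => ->; exact: leq_addr.
have w1W : w1 = window x i (size w1).
  by rewrite -(take_window _ _ sz) E take_size_cat.
by move: w1E; rewrite w1W run_window // size_mkseq => -[].
Qed.

Hypothesis eP : parry e.

(** Both beginnings e_0 ... e_(s-1) and e_0 ... e_(t-1) are suffixes of the
    period, so s is the length of a border and the two runs merge. *)
Lemma run_loop_uniq s t : (s < t)%N ->
  run e s (window x 0 k) = Some s -> run e t (window x 0 k) <> Some t.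
Proof.
move=> st run_s run_t.
have sk := run_loop_lt run_s; have tk := run_loop_lt run_t.
have suffix r i : run e r (window x 0 k) = Some r -> (i < r)%N ->
    nth 0%N (window x 0 k) (k - r + i) = e i.
  move=> run_r ir; have rk := run_loop_lt run_r.
  case/run_decomp: run_r => [[]|[w1 [E _]]]; first by rewrite size_mkseq; lia.
  have sz := congr1 size E; rewrite size_cat !size_mkseq in sz.
  by rewrite E nth_cat sz addnK ltnNge leq_addr /= addKn nth_mkseq.
have bst : border e s t.
  split=> [|i i_s]; first exact: ltnW.
  rewrite -(suffix s i) // -(suffix t (t - s + i)%N) //; last by lia.
  by congr nth; lia.
have := run_merge eP bst run_t; rewrite size_mkseq run_s => uniq_st.
have [E] : Some s = Some t by apply: uniq_st; lia.
by rewrite E ltnn in st.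
Qed.

(** Let r_m be the state reached from 0 after m periods.  The sequence r is
    nondecreasing, since r_(m+1) is reached over the same m periods from a state
    ahead of 0.  It is bounded, since a large value would make a long beginning
    of e periodic.  So it takes the same value twice in a row. *)
Lemma factor_loop : (forall m, block_factor e (window x 0 m)) ->
  exists s, run e s (window x 0 k) = Some s.
Proof.
move=> xF.
have [r rE] : exists r : nat -> nat,
    forall m, run e 0 (window x 0 (m * k)%N) = Some (r m).
  exists (fun m => odflt 0%N (run e 0 (window x 0 (m * k)%N))) => m.
  by have [t ->] := factor_run0 eP (xF (m * k)%N).
have loop m : run e (r m) (window x 0 k) = Some (r m.+1).
  have := rE m.+1; rewrite mulSnr window_cat run_cat rE /=.
  by rewrite (window_periodic 0).
have r_le m : (r m <= r m.+1)%N.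
  have := rE m.+1; rewrite mulSn window_cat => /run_cat_some[q _].
  rewrite -{1}[k]mul1n window_periodic => /(border_run eP (border0 e q)).
  by rewrite rE => -[_ [<-] []].
have [j neq_j] := parry_aperiodic eP k0.
have r_ub m : (r m <= j + k)%N.
  rewrite leqNgt; apply/negP => r_gt; apply: neq_j.
  have [w1 E _] := run0_decomp (rE m).
  have nthE i : (i < r m)%N -> e i = x (size w1 + i)%N%:Z.
    move=> ir; have := congr1 (nth 0%N ^~ (size w1 + i)%N) E => /=.
    rewrite nth_cat ltnNge leq_addr /= addKn nth_mkseq // => <-.
    rewrite nth_mkseq ?add0r //.
    have := congr1 size E; rewrite size_cat !size_mkseq => ->.
    by rewrite ltn_add2l.
  by rewrite !nthE ?addnA ?PoszD ?xk //; lia.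
have [m rm] : exists m, r m.+1 = r m.
  apply: contrapT => h; have lt_r m : (r m < r m.+1)%N.
    rewrite ltn_neqAle r_le andbT; apply/eqP => E.
    by apply: h; exists m; exact: esym.
  have : ((j + k).+1 <= r (j + k).+1)%N.
    by elim: (j + k).+1 => // m IH; exact: leq_ltn_trans IH (lt_r m).
  by rewrite ltnNge r_ub.
by exists (r m); rewrite loop rm.
Qed.

End PeriodicLabels.

(** * Zeta functions of beta-shifts *)

Definition letters (A : nat) (x : biseq 'I_A) : int -> nat :=
  fun i => val (x i).

Definition code_shift (e : nat -> nat) (A : nat) : set (biseq 'I_A) :=
  [set x | forall i k, block_factor e (window (letters x) i k)].

Arguments code_shift : clear implicits.

Lemma beta_shiftE (R : realType) (beta : R) :
  beta_shift beta = code_shift (beta_digit beta) (Num.truncn beta).+1.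
Proof.
by apply/seteqP; split=> x Xx i k; have := Xx i k; rewrite /word_at -map_comp.
Qed.

Section PeriodicPoints.

Variables (T : finType) (k : nat).

Definition periodic_point (u : k.+1.-tuple T) : biseq T :=
  fun i => tnth u (inord (absz (i %% k.+1)%Z)).

Lemma periodic_point_nat u (j : 'I_k.+1) :
  periodic_point u (j : nat)%:Z = tnth u j.
Proof.
by rewrite /periodic_point modz_nat absz_nat modn_small // inord_val.
Qed.

Lemma periodic_point_inj : injective periodic_point.
Proof.
by move=> u v uv; apply: eq_from_tnth => j; rewrite -!periodic_point_nat uv.
Qed.

Lemma iter_shift (x : biseq T) m i : iter m (@shift T) x i = x (i + m%:Z).
Proof.
elim: m i => [|m IH] i; first by rewrite addr0.
by rewrite iterS {1}/shift IH -addrA -PoszD.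
Qed.

Lemma periodic_pointP (x : biseq T) :
  iter k.+1 (@shift T) x = x <-> exists u, periodic_point u = x.
Proof.
split=> [xk|[u <-]].
  exists [tuple x (i : nat)%:Z | i < k.+1]; apply/funext => i.
  rewrite /periodic_point tnth_mktuple inordK; last by lia.
  have xk' j : x (j + k.+1%:Z) = x j by rewrite -[in RHS]xk iter_shift.
  by rewrite (periodic_mod xk' i); congr x; lia.
by apply/funext => i; rewrite iter_shift /periodic_point modzDr.
Qed.

Lemma periodic_count_tuple (X : set (biseq T)) :
  periodic_count X k.+1 = #|[pred u | `[< X (periodic_point u) >]]|.
Proof.
rewrite /periodic_count.
set P := [pred u | _].
have -> : [set x : biseq T | X x /\ iter k.+1 (@shift T) x = x] =
    [set` [fset periodic_point u | u in P]%fset].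
  apply/seteqP; split=> x /=.
    case=> Xx /periodic_pointP[u uE]; apply/imfsetP; exists u => //=.
    by rewrite inE uE.
  move=> /imfsetP[u /=]; rewrite inE => Xu ->; split=> //.
  by apply/periodic_pointP; exists u.
rewrite set_fsetK card_imfset //=; last exact: periodic_point_inj.
by rewrite -cardE.
Qed.

End PeriodicPoints.

Section CodePeriodic.

Variables (e : nat -> nat) (A k : nat).
Hypotheses (eP : parry e) (eA : forall i, (e i < A)%N).

(** Each periodic point has exactly one state s whose run over one period leads
    back to s; the pairs (period, s) are the closed paths. *)
Lemma periodic_count_code :
  periodic_count (code_shift e A) k.+1 = closed_walks e k.+1.
Proof.
rewrite periodic_count_tuple.
rewrite -sum1_card big_mkcond /=.
rewrite /closed_walks; under [RHS]eq_bigr do rewrite -(sum_run eA).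
rewrite exchange_big; apply: eq_bigr => u _ /=.
pose x := letters (periodic_point u).
have xk i : x (i + k.+1%:Z) = x i.
  by rewrite /x /letters /periodic_point modzDr.
have xu : window x 0 k.+1 = map val u.
  have sz : size (window x 0 k.+1) = k.+1 by exact: size_mkseq.
  apply: (@eq_from_nth _ 0%N) => [|i]; rewrite sz ?size_map ?size_tuple // => ik.
  rewrite nth_mkseq // add0r /x /letters (periodic_point_nat u (Ordinal ik)).
  by rewrite (tnth_nth (tnth u ord0)) (nth_map (tnth u ord0)) ?size_tuple.
rewrite inE; case: asboolP => Xu; last first.
  rewrite big1 // => s _; case: eqP => // run_s; case: Xu => i m.
  rewrite -xu in run_s; have [l xl l0] := periodic_labels (ltn0Sn k) xk run_s.
  exact: (factor_window xl).
have [s] := factor_loop (ltn0Sn k) xk eP (Xu 0).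
move=> run_s; have sk := run_loop_lt (ltn0Sn k) run_s.
have uniq_s t : run e t (window x 0 k.+1) = Some t -> t = s.
  move=> run_t; apply/eqP; case: ltngtP => // lt_st.
    by case: (run_loop_uniq (ltn0Sn k) eP lt_st run_t).
  by case: (run_loop_uniq (ltn0Sn k) eP lt_st run_s).
rewrite (bigD1 (Ordinal sk)) //= -xu run_s eqxx big1 // => t ts.
by case: eqP => // /uniq_s tE; case/eqP: ts; apply: val_inj.
Qed.

End CodePeriodic.

Lemma periodic_count_prod n (T : finType) (Y : set (biseq T)) k :
  periodic_count (prod_shift (full_shift n) Y) k.+1 =
  (n ^ k.+1 * periodic_count Y k.+1)%N.
Proof.
rewrite !periodic_count_tuple.
pose f (p : k.+1.-tuple 'I_n * k.+1.-tuple T) : k.+1.-tuple ('I_n * T)%type :=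
  [tuple (tnth p.1 i, tnth p.2 i) | i < k.+1].
pose g (u : k.+1.-tuple ('I_n * T)%type) :=
  ([tuple (tnth u i).1 | i < k.+1], [tuple (tnth u i).2 | i < k.+1]).
have fK : cancel f g.
  by case=> u v; congr pair; apply: eq_from_tnth => i; rewrite !tnth_mktuple.
have gK : cancel g f.
  move=> u; apply: eq_from_tnth => i.
  by rewrite !tnth_mktuple -surjective_pairing.
have -> : (n ^ k.+1)%N = #|{: k.+1.-tuple 'I_n}| by rewrite card_tuple card_ord.
rewrite -(fintype.card_image (can_inj gK)) -cardX.
apply: eq_card => p; rewrite -[p]fK (fintype.mem_image (can_inj gK)) fK.
rewrite !inE /=; apply: asbool_equiv_eq.
have -> : Y (periodic_point p.2) =
    Y (fun i => (periodic_point (f p) i).2).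
  by congr Y; apply/funext => i; rewrite /periodic_point tnth_mktuple.
by split=> [[]|].
Qed.

Lemma card_eq_fset_set (T U : choiceType) (A : set T) (B : set U) :
  (A #= B)%card -> #|` fset_set A| = #|` fset_set B|.
Proof.
move=> AB; have [finB|infB] := pselect (finite_set B).
  have /finite_setP[m Bm] := finB.
  by rewrite (card_fset_set Bm) (card_fset_set (card_eq_trans AB Bm)).
have infA : ~ finite_set A.
  move=> /finite_setP[m Am]; apply: infB; apply/finite_setP; exists m.
  by apply: card_eq_trans Am; rewrite card_eq_sym.
by rewrite /fset_set; case: pselect => //; case: pselect.
Qed.

(** The inverse g is not assumed to commute with the shift; that it sends points
    fixed by the k-th power to such points follows from injectivity of f. *)
Lemma conjugate_periodic_count (A B : finType) (X : set (biseq A))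
    (Y : set (biseq B)) k : (forall x, X x -> X (shift x)) ->
  conjugate X Y -> periodic_count X k = periodic_count Y k.
Proof.
move=> XS [f [g [_ [fX gY] [fK gK] fS]]].
have XSk m x : X x -> X (iter m (@shift A) x).
  by move=> Xx; elim: m => //= m; exact: XS.
have fSk m x : X x -> f (iter m (@shift A) x) = iter m (@shift B) (f x).
  by move=> Xx; elim: m => //= m IH; rewrite fS ?IH //; exact: XSk.
rewrite /periodic_count; apply/card_eq_fset_set; rewrite card_eq_sym.
have -> : [set y : biseq B | Y y /\ iter k (@shift B) y = y] =
    f @` [set x : biseq A | X x /\ iter k (@shift A) x = x].
  apply/seteqP; split=> [y [Yy yk]|_ [x [Xx xk] <-]] /=.
    have Xg := gY _ Yy; exists (g y); last exact: gK.
    split=> //; rewrite -[LHS]fK ?fSk ?gK ?yk //; exact: XSk.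
  by split; [exact: fX|rewrite -fSk // xk].
apply: inj_card_eq => x y /set_mem[Xx _] /set_mem[Xy _] fxy.
by rewrite -[x]fK // fxy fK.
Qed.

Lemma exp_poly_coef (F G : {poly rat}) (m j i : nat) :
    (forall i, (i < m)%N -> F`_i = G`_i) -> (i < m)%N ->
  (F ^+ j)`_i = (G ^+ j)`_i.
Proof.
move=> FG; elim: j i => [|j IH] i im; first by rewrite !expr0.
rewrite !exprS !coefM; apply: eq_bigr => l _.
by rewrite FG ?IH //; apply: leq_ltn_trans im; rewrite ?leq_subr // -ltnS.
Qed.

(** A product of at least two series without constant term has a coefficient of
    index m that only depends on the coefficients of index less than m. *)
Lemma exp_poly_coef_top (F G : {poly rat}) (m j : nat) :
    F`_0 = 0 -> G`_0 = 0 -> (forall i, (i < m)%N -> F`_i = G`_i) ->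
  (F ^+ j.+2)`_m = (G ^+ j.+2)`_m.
Proof.
move=> F0 G0 FG; rewrite !(exprS _ j.+1) !coefM.
apply: eq_bigr => -[i /= im] _; move: im; rewrite ltnS leq_eqVlt.
case/orP=> [/eqP->|im].
  by rewrite subnn !exprS !coef0M F0 G0 !mul0r !mulr0.
rewrite FG //; case: i im => [|i] im; first by rewrite G0 !mul0r.
by rewrite (exp_poly_coef _ FG) //; lia.
Qed.

(** In the coefficient of index k the only new quantity is the linear term
    p_k / k of the exponential. *)
Lemma zeta_eq_count (A B : finType) (X : set (biseq A)) (Y : set (biseq B)) :
  zeta X = zeta Y ->
  forall k, (0 < k)%N -> periodic_count X k = periodic_count Y k.
Proof.
move=> XY k; have [m] := ubnP k; elim: m k => // m IH [//|k] km _.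
have := congr1 (fun z => z k.+1) XY; rewrite /zeta.
set F := \poly_(_ < _) _; set G := \poly_(_ < _) _.
have FG i : (i < k.+1)%N -> F`_i = G`_i.
  move=> ik; rewrite !coef_poly leqW //; case: eqP => // /eqP i0.
  by rewrite IH ?lt0n //; exact: leq_trans ik km.
have F0 : F`_0 = 0 by rewrite coef_poly.
have G0 : G`_0 = 0 by rewrite coef_poly.
rewrite !coef_sum !big_ord_recl /= !coefZ !expr0 !expr1.
under eq_bigr do rewrite coefZ (exp_poly_coef_top _ F0 G0 FG) -coefZ.
move=> /addrI /addIr; rewrite !coef_poly ltnSn /=.
move=> /mulfI /mulIf h; apply/eqP; rewrite -(eqr_nat rat); apply/eqP/h.
  by rewrite invr_eq0 pnatr_eq0.
by rewrite invr_eq0 pnatr_eq0.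
Qed.

Lemma conjugate_zeta (A B : finType) (X : set (biseq A)) (Y : set (biseq B)) :
  (forall x, X x -> X (shift x)) -> conjugate X Y -> zeta X = zeta Y.
Proof.
move=> XS XY; apply/funext => m; rewrite /zeta.
by under eq_poly do rewrite (conjugate_periodic_count _ XS XY).
Qed.

(** * The state as a function of the past *)

Section BaseExpansion.

Variable n : nat.
Local Open Scope nat_scope.

Definition base_value (m : nat) (E : nat -> nat) : nat :=
  \sum_(j < m) E j * n ^ j.

Lemma base_valueS m E :
  base_value m.+1 E = E 0 + n * base_value m (fun j => E j.+1).
Proof.
rewrite /base_value big_ord_recl muln1; congr (_ + _).
by rewrite big_distrr; apply: eq_bigr => j _; rewrite /= mulnCA expnS.
Qed.

Lemma base_value_lt m E :
  (forall j, j < m -> E j < n) -> base_value m E < n ^ m.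
Proof.
elim: m E => [|m IH] E En; first by rewrite /base_value big_ord0.
have h : base_value m (fun j => E j.+1) < n ^ m.
  by apply: IH => j; exact: (En j.+1).
have h0 := En 0 isT; rewrite base_valueS expnS.
apply: leq_trans (_ : n * (base_value m (fun j => E j.+1)).+1 <= _).
  by rewrite mulnS ltn_add2r.
by rewrite leq_mul2l h orbT.
Qed.

Lemma base_value_digit m E k : (forall j, j < m -> E j < n) -> k < m ->
  base_value m E %/ n ^ k %% n = E k.
Proof.
elim: m E k => // m IH E k En; have h0 := En 0 isT.
have n0 : 0 < n by exact: leq_ltn_trans h0.
rewrite base_valueS; case: k => [_|k km].
  by rewrite expn0 divn1 addnC mulnC modnMDl modn_small.
rewrite expnS divnMA (addnC (E 0)) (mulnC n) divnMDl // (divn_small h0) addn0.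
by apply: IH => // j; exact: (En j.+1).
Qed.

Lemma base_value_of m M : M < n ^ m ->
  base_value m (fun j => M %/ n ^ j %% n) = M.
Proof.
elim: m M => [|m IH] M.
  by rewrite /base_value big_ord0; case: M.
have [->|n0 Mn] := posnP n; first by rewrite exp0n.
rewrite base_valueS expn0 divn1 [RHS](divn_eq M n) addnC; congr (_ + _).
rewrite mulnC -[in RHS](IH (M %/ n)) ?ltn_divLR // -?expnSr //; congr (_ * _).
by apply: eq_bigr => j _; rewrite expnS divnMA.
Qed.

End BaseExpansion.

Section FiniteType.

Variables (e : nat -> nat) (d : nat).
Hypotheses (eP : parry e) (e0 : forall j, (d <= j)%N -> e j = 0%N).

(** When e vanishes from d on, every parse returns to 0 within d letters, so
    reading the last d letters from the state 0 gives the current state. *)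
Definition state (x : int -> nat) (i : int) : nat :=
  odflt 0%N (run e 0 (window x (i - d%:Z) d)).

Lemma run_zero_lt s w : (0 < d)%N -> run e s w = Some 0%N -> (s < d)%N.
Proof.
move=> d0; elim: w s => [|b w IH] s /=; first by case=> ->.
rewrite /step; have [//|ds] := ltnP s d.
rewrite e0 // ltn0; case: eqP => //= _ /IH.
by rewrite ltnNge (leq_trans ds).
Qed.

Lemma run_state x l i : labels e x l -> (forall i, (l i < d)%N) ->
  state x i = l i.
Proof.
move=> xl ld; have := run_window xl (i - d%:Z) d; rewrite subrK => run_l.
rewrite /state (run_merge eP (border0 _ _) run_l) //.
by rewrite size_mkseq; apply: leq_trans (ld i) (leq_addl _ _).
Qed.

(** The parses of different windows agree wherever at least d letters precede,
    because each of them merges with the run that starts from 0. *)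
Lemma labels_state x : (0 < d)%N ->
    (forall i k, block_factor e (window x i k)) ->
  labels e x (state x) /\ forall i, (state x i < d)%N.
Proof.
move=> d0 xF.
suff H i :
    step e (state x i) (x i) = Some (state x (i + 1)) /\ (state x i < d)%N.
  by split=> i; have [] := H i.
have [p [q [s [t [_ run_s run_t]]]]] := factor_run (xF (i - d%:Z) d.+1).
have td := run_zero_lt d0 run_t.
have merge r r' j : run e r (window x (j - d%:Z) d) = Some r' -> (r' < d)%N ->
    state x j = r'.
  move=> run_r rd; rewrite /state (run_merge eP (border0 _ _) run_r) //.
  by rewrite size_mkseq; exact: leq_trans rd (leq_addl _ _).
have : state x (i + 1) = t.
  move: run_s; rewrite windowS /=; case: step => [r|] //= run_r.
  by apply: (merge r) => //; rewrite addrAC.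
move=> ->; move: run_s; rewrite windowSr run_rcons subrK.
case E: run => [r|] //= step_r.
have rd : (r < d)%N.
  by apply: (@run_zero_lt _ (x i :: q)) => //=; rewrite step_r.
by rewrite (merge _ _ _ E rd).
Qed.

End FiniteType.

Section Returns.

Variables (e : nat -> nat) (x l : int -> nat).
Hypothesis xl : labels e x l.

Lemma labelsP i :
  l (i + 1) = 0%N /\ (x i < e (l i))%N \/ l (i + 1) = (l i).+1 /\ x i = e (l i).
Proof.
have := xl i; rewrite /step; case: ltnP => [lt_x [<-]|_]; first by left.
by case: eqP => // -> [<-]; right.
Qed.

(** Without a return to 0 the state goes up by one at each letter. *)
Lemma labels_climb i k : (forall m, (m < k)%N -> l (i + m.+1%:Z) <> 0%N) ->
  l (i + k%:Z) = (l i + k)%N.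
Proof.
elim: k => [|k IH] h; first by rewrite addr0 addn0.
have hk : l (i + k%:Z) = (l i + k)%N.
  by apply: IH => m mk; apply: h; exact: ltnW.
have := h k (ltnSn k); rewrite -addn1 PoszD addrA addn1 addnS -hk.
by case: (labelsP (i + k%:Z)) => [[]|[]].
Qed.

Lemma labels_back i j : (j <= l i)%N -> l (i - j%:Z) = (l i - j)%N.
Proof.
elim: j => [|j IH] jl; first by rewrite subr0 subn0.
have := IH (ltnW jl).
have -> : i - j%:Z = i - j.+1%:Z + 1 by lia.
by case: (labelsP (i - j.+1%:Z)) => [[->]|[->]]; lia.
Qed.

Variable d : nat.
Hypothesis ld : forall i, (l i < d)%N.

(** The number of letters of the current block after the position i. *)
Definition wait (i : int) : nat :=
  find (fun m => l (i + m.+1%:Z) == 0%N) (iota 0 d).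

Lemma waitP i : [/\ (wait i < d)%N, l (i + (wait i).+1%:Z) = 0%N &
  forall m, (m < wait i)%N -> l (i + m.+1%:Z) <> 0%N].
Proof.
have : has (fun m => l (i + m.+1%:Z) == 0%N) (iota 0 d).
  apply: contrapT => /negP/hasPn h; have E : l (i + d%:Z) = (l i + d)%N.
    apply: labels_climb => m md; apply/eqP; apply: h; rewrite mem_iota //.
  by have := ld (i + d%:Z); rewrite E ltnNge leq_addl.
move=> h; have wd : (wait i < d)%N by move: h; rewrite has_find size_iota.
split=> // [|m mw].
  by have := nth_find 0%N h; rewrite nth_iota // => /eqP.
have := before_find 0%N mw; rewrite nth_iota; last exact: ltn_trans wd.
by move/eqP.
Qed.

Lemma wait_uniq i k : l (i + k.+1%:Z) = 0%N ->
  (forall m, (m < k)%N -> l (i + m.+1%:Z) <> 0%N) -> wait i = k.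
Proof.
case: (waitP i) => _ w0 wn k0 kn; case: (ltngtP (wait i) k) => //.
  by move/kn.
by move/wn.
Qed.

Lemma wait_back i j : l (i + 1) = 0%N -> (j <= l i)%N -> wait (i - j%:Z) = j.
Proof.
move=> li jl; apply: wait_uniq => [|m mj].
  by have -> : i - j%:Z + j.+1%:Z = i + 1 by lia.
have -> : i - j%:Z + m.+1%:Z = i - (j - m.+1)%N%:Z by lia.
by rewrite labels_back; lia.
Qed.

Lemma labels_recur i : exists m, l (i + m%:Z) = 0%N.
Proof. by have [_ w0 _] := waitP i; exists (wait i).+1. Qed.

End Returns.

Section SlidingBlockCodes.

Variables (T U : Type).

(** A local rule of radius r.  Allowing two positions expresses at once that the
    code depends on finitely many letters and commutes with the shift. *)
Definition sliding (r : nat) (F : (int -> T) -> int -> U) : Prop :=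
  forall x x' i i', (forall j : int, `|j| <= r%:Z -> x (i + j) = x' (i' + j)) ->
  F x i = F x' i'.

End SlidingBlockCodes.

Lemma sliding_shift (T U : finType) r (F : biseq T -> biseq U) :
  sliding r F -> forall x, F (shift x) = shift (F x).
Proof.
by move=> Fr x; apply/funext => i; apply: Fr => j _; rewrite /shift addrAC.
Qed.

Lemma near_agree (T : finType) (x : biseq T) i k :
  nbhs x [set y : biseq T | forall j, (j < k)%N -> y (i + j%:Z) = x (i + j%:Z)].
Proof.
have nF : Filter (nbhs x) by exact: nbhs_filter.
elim: k => [|k IH]; first by apply: filterS (@filterT _ _ nF) => y _ j.
have nk : nbhs x [set y : biseq T | y (i + k%:Z) = x (i + k%:Z)].
  have := @proj_continuous int (fun=> discrete_topology T) (i + k%:Z) x.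
  by move=> /(_ [set x (i + k%:Z)]); apply; rewrite nbhs_principalE.
apply: filterS (filterI IH nk) => y [yk yS] j; rewrite ltnS leq_eqVlt.
by case/orP => [/eqP->|/yk].
Qed.

Lemma sliding_continuous (T U : finType) r (F : biseq T -> biseq U) :
  sliding r F -> continuous F.
Proof.
move=> Fr x; have nF : Filter (nbhs x) by exact: nbhs_filter.
apply/cvg_sup => i B.
rewrite (@nbhsE (initial_topology (fun f : biseq U => f i))).
move=> [_ [[C oC <-]]] /= CFx CB.
apply: filterS (near_agree x (i - r%:Z) (r + r).+1) => y yx; apply: CB.
rewrite /= (_ : F y i = F x i) //; apply: Fr => j jr.
have -> : i + j = i - r%:Z + (absz (j + r%:Z))%:Z by lia.
by apply: yx; lia.
Qed.

(** * Translating blocks *)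

Lemma labels_le e x l i : labels e x l -> (x i <= e (l i))%N.
Proof. by move=> xl; case: (labelsP xl i) => [[_ /ltnW]|[_ ->]]. Qed.

Section Encoding.

Variables (n d : nat) (e : nat -> nat).
Hypothesis n_gt0 : (0 < n)%N.

(** At the last letter of a block, which is in state l i, the letters of E along
    the block become the base n digits of a number M < n^(l i + 1), and x i is
    the remainder and M the quotient of the new letter modulo e_(l i).  The
    other letters of a block are determined by the state. *)
Definition encode (l x E : int -> nat) (i : int) : nat :=
  if x i == e (l i) then scale n e (l i)
  else (x i + e (l i) * base_value n (l i).+1 (fun j => E (i - j%:Z)%R))%N.

Definition decode_letter (l y : int -> nat) (i : int) : nat :=
  if y i == scale n e (l i) then e (l i) else (y i %% e (l i))%N.

(** The digit at i is stored in the last letter of the block, k places ahead. *)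
Definition decode_digit (l y : int -> nat) (i : int) : nat :=
  let k := wait l d i in
  (y (i + k%:Z)%R %/ e (l (i + k%:Z)%R) %/ n ^ k %% n)%N.

Section Encode.

Variables (l x E : int -> nat).
Hypotheses (xl : labels e x l) (ld : forall i, (l i < d)%N).
Hypothesis En : forall i, (E i < n)%N.

Lemma encode_lt i : (x i < e (l i))%N -> (encode l x E i < scale n e (l i))%N.
Proof.
move=> xe; rewrite /encode ltn_eqF // /scale [ltnRHS]mulnC.
set M := base_value _ _ _.
have Mn : (M < n ^ (l i).+1)%N by apply: base_value_lt.
apply: leq_trans (_ : e (l i) * M.+1 <= _)%N; last by rewrite leq_mul2l Mn orbT.
by rewrite mulnS ltn_add2r.
Qed.

(** The parse is left unchanged, so each code can read it off its input. *)
Lemma labels_encode : labels (scale n e) (encode l x E) l.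
Proof.
move=> i; rewrite /step; case: (labelsP xl i) => [[-> xe]|[-> xe]].
  by rewrite encode_lt.
by rewrite /encode xe eqxx ltnn eqxx.
Qed.

Lemma encode_letterK : decode_letter l (encode l x E) = x.
Proof.
apply/funext => i; rewrite /decode_letter.
case: (labelsP xl i) => [[_ xe]|[_ xe]]; last by rewrite /encode xe !eqxx.
rewrite ltn_eqF ?encode_lt // /encode ltn_eqF //.
by rewrite addnC mulnC modnMDl modn_small.
Qed.

Lemma encode_digitK : decode_digit l (encode l x E) = E.
Proof.
apply/funext => i; rewrite /decode_digit.
have [_ + wn] := waitP xl ld i; rewrite -addn1 PoszD addrA.
set k := wait l d i => lk.
have lik : l (i + k%:Z) = (l i + k)%N by exact: (labels_climb xl).
case: (labelsP xl (i + k%:Z)) => [[_ xe]|[]]; last by rewrite lk.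
rewrite /encode ltn_eqF // addnC mulnC divnMDl ?(leq_ltn_trans _ xe) //.
rewrite (divn_small xe) addn0 base_value_digit ?addrK //.
by rewrite lik ltnS leq_addl.
Qed.

End Encode.

Section Decode.

Variables (l y : int -> nat).
Hypotheses (yl : labels (scale n e) y l) (ld : forall i, (l i < d)%N).

Lemma labels_decode : labels e (decode_letter l y) l.
Proof.
move=> i; rewrite /step /decode_letter.
case: (labelsP yl i) => [[-> ye]|[-> ye]]; last by rewrite ye eqxx ltnn eqxx.
rewrite ltn_eqF // ltn_pmod //; move: ye; rewrite /scale.
by case: (e (l i)) => //; rewrite muln0.
Qed.

Lemma decodeK : encode l (decode_letter l y) (decode_digit l y) = y.
Proof.
apply/funext => i; rewrite /encode {1 2}/decode_letter.
case: (labelsP yl i) => [[li ye]|[_ ye]]; last by rewrite ye !eqxx.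
have e_gt0 : (0 < e (l i))%N.
  by move: ye; rewrite /scale; case: (e (l i)) => //; rewrite muln0.
rewrite (ltn_eqF ye) ltn_eqF ?ltn_pmod // [RHS](divn_eq _ (e (l i))).
rewrite addnC mulnC; congr (_ * _ + _)%N.
rewrite -[RHS](@base_value_of n (l i).+1); last by rewrite ltn_divLR.
apply: eq_bigr => -[j /= jl] _; rewrite /decode_digit (wait_back yl ld li) //.
by rewrite subrK.
Qed.

End Decode.

End Encoding.

Section State.

Variables (e : nat -> nat) (d : nat).

Lemma state_le x i : (state e d x i <= d)%N.
Proof.
rewrite /state; case E: run => [t|] //=.
have [w1 /(congr1 size) sz _] := run0_decomp E.
by move: sz; rewrite size_cat !size_mkseq => ->; exact: leq_addl.
Qed.

Lemma state_agree (x x' : int -> nat) i i' (r : nat) :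
    (forall j : int, `|j| <= r%:Z -> x (i + j) = x' (i' + j)) ->
  forall m : int, `|m| + d%:Z <= r%:Z ->
    state e d x (i + m) = state e d x' (i' + m).
Proof.
move=> xx' m mr; rewrite /state; congr (odflt _ (run _ _ _)).
have jE k j : k + m - d%:Z + j = k + (m - d%:Z + j) by rewrite !addrA.
apply/eq_in_map => j; rewrite mem_iota /= add0n => jd.
by rewrite !jE; apply: xx'; lia.
Qed.

End State.

Section Conjugacy.

Variables (n d a b : nat) (e : nat -> nat).
Hypotheses (n_gt0 : (0 < n)%N) (d_gt0 : (0 < d)%N).
Hypotheses (eP : parry e) (e0 : forall j, (d <= j)%N -> e j = 0%N).
Hypotheses (fP : parry (scale n e)).
Hypotheses (ea : forall j, (e j <= a)%N) (fb : forall j, (scale n e j <= b)%N).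

Local Notation f := (scale n e).
Local Notation digits z := (letters (fun i => (z i).1)).
Local Notation word z := (letters (fun i => (z i).2)).

Definition join_code (z : biseq ('I_n * 'I_a.+1)%type) : biseq 'I_b.+1 :=
  fun i => inord (encode n e (state e d (word z)) (word z) (digits z) i).

Definition split_code (y : biseq 'I_b.+1) : biseq ('I_n * 'I_a.+1)%type :=
  fun i => let l := state f d (letters y) in
  (Ordinal (ltn_pmod (letters y (i + (wait l d i)%:Z) %/
      e (l (i + (wait l d i)%:Z)) %/ n ^ wait l d i) n_gt0),
   inord (decode_letter n e l (letters y) i)).

Lemma join_code_sliding : sliding d join_code.
Proof.
move=> z z' i i' zz'; rewrite /join_code; congr inord.
have ww j : `|j| <= d%:Z -> word z (i + j) = word z' (i' + j).
  by move=> jd; rewrite /letters zz'.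
rewrite /encode; have -> : state e d (word z) i = state e d (word z') i'.
  by rewrite -[i]addr0 -[i']addr0; apply: (state_agree _ ww); lia.
have := ww 0; rewrite !addr0 => -> //.
case: eqP => // _; congr (_ + _ * _)%N; apply: eq_bigr => -[j /= jl] _.
by rewrite /letters zz' //; have := state_le e d (word z') i'; lia.
Qed.

Lemma split_code_sliding : sliding (d + d) split_code.
Proof.
move=> y y' i i' yy'; rewrite /split_code.
set l := state f d (letters y); set l' := state f d (letters y').
have ww j : `|j| <= (d + d)%N%:Z -> letters y (i + j) = letters y' (i' + j).
  by move=> jd; rewrite /letters yy'.
have ll j : `|j| <= d%:Z -> l (i + j) = l' (i' + j).
  by move=> jd; apply: (state_agree _ ww); lia.
have wE : wait l d i = wait l' d i'.
  apply: eq_in_find => m; rewrite mem_iota /= => md; rewrite ll //; lia.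
have wd : (wait l' d i' <= d)%N by rewrite -[leqRHS](size_iota 0) find_size.
congr pair.
  by apply: val_inj; rewrite /= wE ll ?ww //; lia.
have := ww 0; have := ll 0; rewrite !addr0 /decode_letter => -> // -> //.
Qed.

Lemma join_code_letters z : code_shift e a.+1 (fun i => (z i).2) ->
  [/\ forall i, (state e d (word z) i < d)%N,
      labels e (word z) (state e d (word z)),
      letters (join_code z) = encode n e (state e d (word z)) (word z) (digits z) &
      state f d (letters (join_code z)) = state e d (word z)].
Proof.
move=> zX; have [zl ld] := labels_state eP e0 d_gt0 zX.
have dn i : (digits z i < n)%N by exact: ltn_ord.
have lf := labels_encode zl dn.
have joinE : letters (join_code z) =
    encode n e (state e d (word z)) (word z) (digits z).
  apply/funext => i; apply: inordK; rewrite ltnS.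
  exact: leq_trans (labels_le i lf) (fb _).
split=> //; apply/funext => i; rewrite joinE.
exact: (run_state fP _ lf).
Qed.

Lemma scale0 j : (d <= j)%N -> f j = 0%N.
Proof. by move=> /e0; rewrite /scale => ->; rewrite muln0. Qed.

Lemma split_code_letters y : code_shift f b.+1 y ->
  [/\ forall i, (state f d (letters y) i < d)%N,
      labels f (letters y) (state f d (letters y)),
      word (split_code y) = decode_letter n e (state f d (letters y)) (letters y),
      digits (split_code y) = decode_digit n d e (state f d (letters y)) (letters y) &
      state e d (word (split_code y)) = state f d (letters y)].
Proof.
move=> yY; have [yl ld] := labels_state fP scale0 d_gt0 yY.
have le := labels_decode yl.
have wordE : word (split_code y) =
    decode_letter n e (state f d (letters y)) (letters y).
  apply/funext => i; apply: inordK; rewrite ltnS.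
  exact: leq_trans (labels_le i le) (ea _).
split=> //; apply/funext => i; rewrite wordE.
exact: (run_state eP _ le).
Qed.

Lemma labels_code_shift (g : nat -> nat) (c : nat) (x : biseq 'I_c) l :
    labels g (letters x) l -> (forall i, (l i < d)%N) ->
  code_shift g c x.
Proof.
by move=> xl ld i k; apply: (factor_window xl); exact: (labels_recur xl ld).
Qed.

Lemma scale_conjugate :
  conjugate (code_shift f b.+1) (prod_shift (full_shift n) (code_shift e a.+1)).
Proof.
exists split_code, join_code; split.
- by split; apply: continuous_subspaceT;
    [exact: sliding_continuous split_code_sliding|
     exact: sliding_continuous join_code_sliding].
- split=> [y yY|z [_ zX]].
    split=> //; have [ld yl wordE _ _] := split_code_letters yY.
    by apply: (@labels_code_shift _ _ _ (state f d (letters y))) => //;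
      rewrite wordE; exact: labels_decode.
  have [ld zl joinE _] := join_code_letters zX.
  apply: (@labels_code_shift _ _ _ (state e d (word z))) => //; rewrite joinE.
  by apply: labels_encode => // i; exact: ltn_ord.
- split=> [y yY|z [_ zX]]; apply/funext => i.
    have [ld yl wordE digitE stateE] := split_code_letters yY.
    apply: val_inj; rewrite /join_code /= stateE wordE digitE decodeK //.
    by rewrite inord_val.
  have [ld zl joinE stateE] := join_code_letters zX.
  have dn j : (digits z j < n)%N by exact: ltn_ord.
  rewrite /split_code stateE joinE [RHS]surjective_pairing; congr pair.
    apply: val_inj; have := encode_digitK zl ld dn.
    by move=> /(congr1 (fun h => h i)).
  by rewrite encode_letterK // inord_val.
- by move=> y _; apply: sliding_shift split_code_sliding y.
Qed.

End Conjugacy.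

(** * Multiplying the base *)

Section MultipliedBase.

Variables (R : realType) (gamma : R) (n d : nat) (e : nat -> nat).
Hypotheses (d_gt0 : (0 < d)%N) (n_gt0 : (0 < n)%N) (gamma_gt1 : 1 < gamma).
Hypotheses (eP : parry e) (e0 : forall j, (d <= j)%N -> e j = 0%N).
Hypothesis gammaE : gamma ^+ d = \sum_(j < d) (e j)%:R * gamma ^+ (d - j.+1).

Let beta := n%:R * gamma.

Let beta_gt1 : 1 < beta.
Proof.
have n1 : 1 <= n%:R :> R by rewrite (ler_nat R 1).
by apply: lt_le_trans gamma_gt1 _; rewrite ler_peMl // ltW // (lt_trans ltr01).
Qed.

Let digits_gamma : beta_digit gamma = e.
Proof. exact: finite_beta_digit gammaE. Qed.

Lemma parry_scale_conjugate : parry (scale n e) ->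
  conjugate (beta_shift beta) (prod_shift (full_shift n) (beta_shift gamma)).
Proof.
move=> fP; have f0 j : (d <= j)%N -> scale n e j = 0%N.
  by move=> /e0; rewrite /scale => ->; rewrite muln0.
have digits_beta : beta_digit beta = scale n e.
  apply: (finite_beta_digit beta_gt1 fP f0).
  rewrite /beta exprMn gammaE mulr_sumr; apply: eq_bigr => j _.
  rewrite /scale natrM natrX exprMn -{1}(subnKC (ltn_ord j)) exprD.
  by rewrite -!mulrA; congr (_ * _); rewrite mulrCA.
rewrite !beta_shiftE digits_beta digits_gamma.
apply: (@scale_conjugate n d) => // j.
  by rewrite -digits_gamma; exact: beta_digit_le.
by rewrite -digits_beta; exact: beta_digit_le.
Qed.

(** Equal periodic counts force the digit sequence of n gamma to be scale n e,
    whether or not the latter was known to be parry. *)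
Lemma zeta_eq_parry_scale :
    zeta (beta_shift beta) =
      zeta (prod_shift (full_shift n) (beta_shift gamma)) ->
  parry (scale n e).
Proof.
move=> /zeta_eq_count zE.
suff <- : beta_digit beta = scale n e by exact: parry_beta_digit.
apply: closed_walks_inj => -[//|k] _.
rewrite closed_walks_scale // -digits_gamma.
have countE (b : R) : 1 < b ->
    periodic_count (beta_shift b) k.+1 = closed_walks (beta_digit b) k.+1.
  move=> b_gt1; rewrite beta_shiftE periodic_count_code // => [|i].
    exact: parry_beta_digit.
  by rewrite ltnS; exact: beta_digit_le.
by rewrite -!countE // zE // periodic_count_prod.
Qed.

Lemma conjugate_zeta_beta (T : finType) (Y : set (biseq T)) :
  conjugate (beta_shift beta) Y -> zeta (beta_shift beta) = zeta Y.
Proof.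
apply: conjugate_zeta => x Xx; have [_ _ <-] := subshift_beta_shift beta_gt1.
by exists x.
Qed.

End MultipliedBase.

Theorem theorem5p7 (R : realType) (d : nat) (a : nat -> nat) (gamma : R)
    (n : nat) :
  (1 <= d)%N -> (1 <= a d.-1)%N -> (1 <= a 0)%N ->
  gt_all_shifts [seq a (d - j)%N | j <- iota 1 d] ->
  gamma ^+ d = \sum_(i < d) (a i)%:R * gamma ^+ i ->
  1 < gamma ->
  (2 <= n)%N ->
  let w := [seq (n ^ j * a (d - j))%N | j <- iota 1 d] in
  (gt_all_shifts w ->
     conjugate (beta_shift (n%:R * gamma))
               (prod_shift (full_shift n) (beta_shift gamma))) /\
  (~ gt_all_shifts w ->
     (~ SFT (beta_shift (n%:R * gamma)) \/
      zeta (beta_shift (n%:R * gamma)) <>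
        zeta (prod_shift (full_shift n) (beta_shift gamma))) /\
     ~ conjugate (beta_shift (n%:R * gamma))
                 (prod_shift (full_shift n) (beta_shift gamma))).
Proof.
move=> d_gt0 _ _ [_ cP] gammaE gamma_gt1 n_gt1 w.
have n_gt0 : (0 < n)%N by exact: ltnW.
set c := [seq a (d - j)%N | j <- iota 1 d] in cP.
pose e := nth 0%N c.
have eE j : (j < d)%N -> e j = a (d - j.+1)%N.
  by move=> jd; rewrite /e (nth_map 0%N) ?size_iota // nth_iota.
have e0 j : (d <= j)%N -> e j = 0%N.
  by move=> dj; rewrite /e nth_default // size_map size_iota.
have wE : nth 0%N w = scale n e.
  apply/funext => j; rewrite /scale; have [jd|dj] := ltnP j d.
    by rewrite (nth_map 0%N) ?size_iota // nth_iota // eE.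
  by rewrite e0 // muln0 nth_default // size_map size_iota.
have w_neq0 : w <> [::] by rewrite /w; case: (d) d_gt0.
have wP : gt_all_shifts w <-> parry (scale n e).
  by rewrite /gt_all_shifts wE; split=> [[]|].
have gammaE' : gamma ^+ d = \sum_(j < d) (e j)%:R * gamma ^+ (d - j.+1).
  rewrite gammaE (reindex_inj rev_ord_inj); apply: eq_bigr => j _ /=.
  by rewrite eE.
split=> [/wP fP|wN].
  exact: (parry_scale_conjugate d_gt0 n_gt0 gamma_gt1 cP e0 gammaE').
have zN : zeta (beta_shift (n%:R * gamma)) <>
    zeta (prod_shift (full_shift n) (beta_shift gamma)).
  move=> /(zeta_eq_parry_scale n_gt0 gamma_gt1 cP e0 gammaE') fP.
  exact/wN/wP.
by split; [right|move=> /(conjugate_zeta_beta n_gt0 gamma_gt1)].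
Qed.
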